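(* Let $(A,d,\Delta_1,\Delta_2,\dots)$ be a multicomplex over a field $\mathbb K$ of characteristic $0$. It admits a Hodge-to-de Rham degeneration data if and only if there exists an element $R(z)=\sum_{n\ge1}R_nz^n$ in $\mathrm{End}(A)[[z]]$ satisfying $$e^{R(z)}\,d\,e^{-R(z)}=d+\Delta_1z+\Delta_2z^2+\cdots .$$
   Context: Multicomplex: a graded vector space $A$ with linear operators $\Delta_n$, $n\ge0$, of degree $2n-1$, where $\Delta_0=d$, satisfying $\sum_{i=0}^n\Delta_i\Delta_{n-i}=0$ for all $n\ge0$. Hodge-to-de Rham degeneration data for $(A,d,\Delta_1,\Delta_2,\dots)$: a homotopy retract of $(A,d)$ onto $(H(A),0)$, where $H(A)=H(A,d)$, that is, a chain map $p:A\to H(A)$, a quasi-isomorphism $i:H(A)\to A$ and a linear map $h:A\to A$ of degree $1$ with $ip-\mathrm{id}_A=dh+hd$, such that for every $n\ge1$ $$\sum_{i_1+\cdots+i_k=n}p\,\Delta_{i_1}h\,\Delta_{i_2}h\cdots h\,\Delta_{i_k}\,i=0,$$ the sum being over all $k\ge1$ and $i_1,\dots,i_k\ge1$ with the given sum. $\mathrm{End}(A)[[z]]$ is the algebra of formal power series in $z$ with coefficients in the endomorphism algebra $\mathrm{End}(A)=\mathrm{Hom}(A,A)$ of the graded vector space $A$. *)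

(* Defs.v *)
From HB Require Import structures.
From mathcomp Require Import all_boot all_order all_algebra.
From mathcomp Require Import generic_quotient ring_quotient.
From mathcomp Require Import boolp classical_sets functions.
Set Implicit Arguments.
Unset Strict Implicit.
Unset Printing Implicit Defensive.
Import GRing.Theory.
Local Open Scope ring_scope.
Local Open Scope quotient_scope.

Section Gradings.
Variable K : fieldType.

(* A Z-grading is an internal direct sum decomposition V = \bigoplus_k gr k. *)
Definition grading (V : lmodType K) (gr : int -> set V) : Prop :=
  [/\ forall k, gr k 0 /\
        (forall (a : K) x y, gr k x -> gr k y -> gr k (a *: x + y)),
      forall x, exists (s : seq int) (c : int -> V),
        (forall k, gr k (c k)) /\ x = \sum_(k <- s) c k
    & forall (s : seq int) (c : int -> V), uniq s ->
        (forall k, gr k (c k)) -> \sum_(k <- s) c k = 0 ->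
        forall k, k \in s -> c k = 0].

Definition homogeneous (V W : lmodType K) (grV : int -> set V)
    (grW : int -> set W) (n : int) (f : V -> W) : Prop :=
  forall k x, grV k x -> grW (k + n) (f x).

(* The elements of End(V) = \bigoplus_n Hom(V, V)_n: the finite sums of
   homogeneous linear endomorphisms. *)
Definition graded_End (V : lmodType K) (gr : int -> set V) : set (V -> V) :=
  [set f | exists (m : nat) (deg : 'I_m -> int) (g : 'I_m -> {linear V -> V}),
      (forall j, homogeneous gr gr (deg j) (g j)) /\
      f = \sum_(j < m) (g j : V -> V)].

End Gradings.

Section Homology.
Variables (K : fieldType) (V : lmodType K) (d : {linear V -> V}).

Definition is_cycle : {pred V} := [pred x | d x == 0].

Fact is_cycle_submod_closed : submod_closed is_cycle.
Proof.
split=> [|a x y]; rewrite !inE ?linear0// => /eqP dx /eqP dy.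
by rewrite linearP dx dy scaler0 addr0.
Qed.

HB.instance Definition _ :=
  GRing.isSubmodClosed.Build K V is_cycle is_cycle_submod_closed.

Record cycles := Cycle { cycle_val :> V; _ : cycle_val \in is_cycle }.

HB.instance Definition _ := [isSub for cycle_val].
HB.instance Definition _ := [Choice of cycles by <:].
HB.instance Definition _ := [SubChoice_isSubLmodule of cycles by <:].

Definition is_boundary : {pred cycles} :=
  [pred z : cycles | `[< exists y, val z = d y >]].

Lemma is_boundaryP (z : cycles) :
  reflect (exists y, val z = d y) (z \in is_boundary).
Proof. exact: asboolP. Qed.

Fact is_boundary_submod_closed : submod_closed is_boundary.
Proof.
split=> [|a x y]; first by apply/is_boundaryP; exists 0; rewrite linear0.
move=> /is_boundaryP[u xu] /is_boundaryP[v yv]; apply/is_boundaryP.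
by exists (a *: u + v); rewrite linearP -xu -yv.
Qed.

HB.instance Definition _ :=
  GRing.isSubmodClosed.Build K cycles is_boundary is_boundary_submod_closed.

(* ker d / im d when d \o d = 0 *)
Definition homology : Type := Quotient.quot is_boundary.

HB.instance Definition _ := EqQuotient.on homology.
HB.instance Definition _ := GRing.Zmodule.on homology.
HB.instance Definition _ :=
  ZmodQuotient.on homology.

Definition homology_class (z : cycles) : homology := \pi_homology z.

Definition homology_scale (a : K) (c : homology) : homology :=
  homology_class (a *: repr c).

Lemma homology_classP (z t : cycles) :
  homology_class z = homology_class t <-> exists y, val z - val t = d y.
Proof.
have E : (z - t \in is_boundary) = (homology_class z == homology_class t).
  exact: (Quotient.idealrBE is_boundary z t).
split=> [/eqP|zt]; first by rewrite -E => /is_boundaryP.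
by apply/eqP; rewrite -E; apply/is_boundaryP.
Qed.

Lemma homology_scaleE a z :
  homology_scale a (homology_class z) = homology_class (a *: z).
Proof.
apply/homology_classP.
have /homology_classP[y yE] : homology_class (repr (homology_class z))
  = homology_class z by exact: reprK.
by exists (a *: y); rewrite [RHS]linearZ_LR -yE scalerBr.
Qed.

Lemma homology_classD z t :
  homology_class (z + t) = homology_class z + homology_class t.
Proof. exact: (raddfD \pi_homology). Qed.

Lemma homology_classK c : homology_class (repr c) = c.
Proof. exact: reprK. Qed.

Fact homology_scaleA a b c :
  homology_scale a (homology_scale b c) = homology_scale (a * b) c.
Proof. by rewrite -(homology_classK c) !homology_scaleE scalerA. Qed.

Fact homology_scale1 : left_id 1 homology_scale.
Proof. by move=> c; rewrite -(homology_classK c) homology_scaleE scale1r. Qed.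

Fact homology_scaleDr : right_distributive homology_scale +%R.
Proof.
move=> a c e; rewrite -(homology_classK c) -(homology_classK e).
by rewrite -homology_classD !homology_scaleE -homology_classD scalerDr.
Qed.

Fact homology_scaleDl c : {morph homology_scale^~ c : a b / a + b}.
Proof.
move=> a b /=; rewrite -(homology_classK c).
by rewrite !homology_scaleE -homology_classD scalerDl.
Qed.

HB.instance Definition _ := GRing.Zmodule_isLmodule.Build K homology
  homology_scaleA homology_scale1 homology_scaleDr homology_scaleDl.

Definition homology_grading (gr : int -> set V) (k : int) : set homology :=
  [set c | exists2 z : cycles, gr k (val z) & c = homology_class z].

End Homology.

Section ChainMaps.
Variables (K : fieldType) (V W : lmodType K).
Variables (dV : {linear V -> V}) (dW : {linear W -> W}).

Definition commutes_with_d (f : V -> W) : Prop :=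
  forall x, f (dV x) = dW (f x).

Definition chain_map (grV : int -> set V) (grW : int -> set W) (f : V -> W) :=
  homogeneous grV grW 0 f /\ commutes_with_d f.

Variables (f : {linear V -> W}) (fC : commutes_with_d f).

Fact cycle_map_subproof (z : cycles dV) : f (val z) \in is_cycle dW.
Proof.
by rewrite inE -fC; have := valP z; rewrite inE => /eqP ->; rewrite linear0.
Qed.

Definition cycle_map (z : cycles dV) : cycles dW :=
  Cycle (cycle_map_subproof z).

Definition homology_map (c : homology dV) : homology dW :=
  homology_class (cycle_map (repr c)).

Lemma homology_mapE z :
  homology_map (homology_class z) = homology_class (cycle_map z).
Proof.
apply/homology_classP.
have /homology_classP[y yE] : homology_class (repr (homology_class z))
  = homology_class z by exact: homology_classK.
by exists (f y); rewrite /= -linearB yE fC.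
Qed.

End ChainMaps.

Definition quasi_isomorphism (K : fieldType) (V W : lmodType K)
    (grV : int -> set V) (dV : {linear V -> V})
    (grW : int -> set W) (dW : {linear W -> W}) (f : {linear V -> W}) : Prop :=
  homogeneous grV grW 0 f /\
  exists fC : commutes_with_d dV dW f, bijective (homology_map fC).

Section Multicomplexes.
Variables (K : fieldType) (A : lmodType K) (gr : int -> set A).

Definition multicomplex (Delta : nat -> {linear A -> A}) : Prop :=
  (forall n : nat, homogeneous gr gr (2 * n%:Z - 1) (Delta n)) /\
  (forall (n : nat) (x : A), \sum_(i < n.+1) Delta i (Delta (n - i)%N x) = 0).

(* The homology H(A, d) carries the induced grading and the zero differential.
   The identity hr_p \o hr_i = id is not part of the structure. *)
Record homotopy_retract (d : {linear A -> A}) := HomotopyRetract {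
  hr_p : {linear A -> homology d};
  hr_i : {linear homology d -> A};
  hr_h : {linear A -> A};
  hr_p_chain : chain_map d \0 gr (homology_grading gr) hr_p;
  hr_i_quasi : quasi_isomorphism (homology_grading gr) \0 gr d hr_i;
  hr_h_degree : homogeneous gr gr 1 hr_h;
  hr_homotopy : forall x, hr_i (hr_p x) - x = d (hr_h x) + hr_h (d x)
}.

(* Delta_{i_1} h Delta_{i_2} h ... h Delta_{i_k} for s = [:: i_1; ...; i_k] *)
Fixpoint zigzag (Delta : nat -> A -> A) (h : A -> A) (s : seq nat) (x : A) : A :=
  match s with
  | [::] => x
  | [:: m] => Delta m x
  | m :: s' => Delta m (h (zigzag Delta h s' x))
  end.

(* A composition of n has at most n parts, all of them at most n; so the sum
   runs over k-tuples, 1 <= k <= n, of elements of {0, ..., n}. *)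
Definition degeneration_data (Delta : nat -> {linear A -> A})
    (r : homotopy_retract (Delta 0%N)) : Prop :=
  forall (n : nat) (x : homology (Delta 0%N)), (1 <= n)%N ->
    \sum_(1 <= k < n.+1)
      \sum_(t : k.-tuple 'I_n.+1 |
            all (leq 1) (map val t) && (sumn (map val t) == n))
        hr_p r (zigzag Delta (hr_h r) (map val t) (hr_i r x)) = 0.

End Multicomplexes.

(* Formal power series in z with coefficients in the endomorphisms of A
   (product: composition), as coefficient sequences. *)
Section EndSeries.
Variables (K : fieldType) (A : lmodType K).
Implicit Types F G : nat -> A -> A.

Definition es_const (f : A -> A) : nat -> A -> A :=
  fun n => if n == 0%N then f else 0.

Definition es_mul F G : nat -> A -> A :=
  fun n => \sum_(i < n.+1) (F i \o G (n - i)%N).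

Definition es_pow F (k : nat) : nat -> A -> A :=
  iter k (es_mul F) (es_const id).

(* e^F = \sum_k F^k / k! for F without constant term: then F^k only has terms
   of order >= k, so that k <= n suffices for the coefficient of z^n. *)
Definition es_exp F : nat -> A -> A :=
  fun n => \sum_(k < n.+1) (k`!%:R^-1 : K) *: es_pow F k n.

End EndSeries.

(* Main.v *)
Require Import Defs.
From HB Require Import structures.
From mathcomp Require Import all_boot all_order all_algebra.
From mathcomp Require Import ring.
From mathcomp Require Import boolp classical_sets functions.
Set Implicit Arguments.
Unset Strict Implicit.
Unset Printing Implicit Defensive.
Import GRing.Theory.
Local Open Scope ring_scope.

(** The whole argument takes place in the ring S = End(A)[[z]].  Write
    delta = sum_(n >= 1) Delta_n z^n and D = d + delta; the multicomplex
    equations say D^2 = 0.  For a homotopy retract (p, i, h) put pi = i p, so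
    that pi - 1 = d h + h d and d pi = pi d = 0, and let iota be the solution
    of iota = pi + h delta iota, that is, iota = (1 - h delta)^-1 pi.
    Expanding the geometric series, the coefficients of p delta iota are the
    zigzag sums (lemma perturbed_inclusion_coef); hence degeneration amounts to
    pi delta iota = 0.

    From degeneration to R.  If pi delta iota = 0, the homotopy relation gives
    d iota = - delta iota - h d delta iota, so D iota = - h d delta iota; and
    d delta = - delta D because D^2 = d^2 = 0.  Thus D iota = h delta (D iota),
    and D iota = 0 because h delta has no constant term.  The series
      Phi = iota - D h - h d
    is therefore the sum of iota, which D and d kill on either side, and of
    a null-homotopic map, so D Phi = Phi d.  Its constant term is
    pi - d h - h d = 1, so Phi = e^R for some R without constant term and
    e^R d e^-R = D.  As Phi_n has degree 2n, so has R_n, which puts R_n in the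
    graded endomorphism algebra (lemma conjugation_of_degeneration).

    From R to degeneration.  Over a field there is a homotopy retract with
    p i = 1, obtained from a homogeneous g with d g d = d (lemma
    strict_retract_exists).  Let varpi = pi (1 - delta h)^-1 and
    beta = varpi delta pi = pi delta iota, the transferred differential.  The
    perturbed projection is a chain map, varpi D = beta varpi.  Since
    D e^R pi = e^R d pi = 0, this gives beta (varpi e^R pi) = 0; but
    varpi e^R pi has constant term pi and beta = beta pi, so beta is equal to
    beta times a series without constant term, and beta = 0 (lemma
    degeneration_of_intertwiner).

    All fixed-point equations (inverses of 1 - h delta and 1 - delta h, and
    the logarithm of Phi) are solved by one contraction principle for the
    z-adic filtration, which also carries degree bounds along. *)

(** * Complements and generalized inverses *)

Section LinearAlgebra.
Variable K : fieldType.

(** Linear maps are built below from their graphs. Compatibility with linear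
    combinations makes a relation single-valued as soon as its fibre over 0 is
    trivial. *)
Lemma linear_of_relation (V W : lmodType K) (rel : V -> W -> Prop) :
    (forall x, exists y, rel x y) ->
    (forall a x y x' y', rel x y -> rel x' y' ->
       rel (a *: x + x') (a *: y + y')) ->
    (forall y, rel 0 y -> y = 0) ->
  exists f : {linear V -> W}, forall x y, rel x y <-> f x = y.
Proof.
move=> tot lin rel0.
have fun_rel x y y' : rel x y -> rel x y' -> y = y'.
  move=> xy /(lin (-1) _ _ _ _ xy); rewrite !scaleN1r addNr => /rel0.
  by rewrite addrC => /subr0_eq.
have [f fE] := choice tot.
have lin_f : linear f.
  by move=> a x y; apply: fun_rel (fE _) (lin _ _ _ _ _ _ _).
pose fL : {linear V -> W} := HB.pack f (GRing.isLinear.Build _ _ _ _ f lin_f).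
exists fL => x y; split=> [|<-]; last exact: fE.
exact: fun_rel (fE x).
Qed.

Definition subspace (V : lmodType K) (U : set V) : Prop :=
  U 0 /\ forall (a : K) x y, U x -> U y -> U (a *: x + y).

Lemma subspaceD (V : lmodType K) (U : set V) x y :
  subspace U -> U x -> U y -> U (x + y).
Proof. by case=> _ lin Ux Uy; rewrite -[x]scale1r; apply: lin. Qed.

Lemma subspaceZ (V : lmodType K) (U : set V) a x :
  subspace U -> U x -> U (a *: x).
Proof. by case=> U0 lin Ux; rewrite -[_ *: x]addr0; apply: lin. Qed.

Lemma subspaceB (V : lmodType K) (U : set V) x y :
  subspace U -> U x -> U y -> U (x - y).
Proof.
move=> subU Ux Uy; rewrite -scaleN1r.
by apply: subspaceD => //; apply: subspaceZ.
Qed.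

Lemma subspace_sum (V : lmodType K) (U : set V) (I : Type) (r : seq I)
    (F : I -> V) :
  subspace U -> (forall i, U (F i)) -> U (\sum_(i <- r) F i).
Proof.
move=> subU UF; elim/big_ind: _ => // [|x y]; first by case: subU.
exact: subspaceD.
Qed.

(** Zorn's lemma on the linear subsets meeting U trivially. The empty set is
    admitted among them so that the empty chain is bounded; a maximal element
    is nonempty because the zero subspace is a candidate. *)
Lemma complement_exists (V : lmodType K) (U : set V) : subspace U ->
  exists C : set V, [/\ subspace C, forall x, C x -> U x -> x = 0
    & forall x, exists2 c, C c & U (x - c)].
Proof.
move=> subU; have [U0 linU] := subU.
pose P (C : set V) := (forall (a : K) x y, C x -> C y -> C (a *: x + y)) /\
  (forall x, C x -> U x -> x = 0).
have [F FP Ftot|C [[linC CU] maxC]] := @Zorn_bigcup V P.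
  split=> [a x y [X FX Xx] [Y FY Yy]|x [X FX Xx]]; last exact: (FP X FX).2.
  have [XY|YX] := Ftot _ _ FX FY.
    by exists Y => //; apply: (FP Y FY).1 => //; apply: XY.
  by exists X => //; apply: (FP X FX).1 => //; apply: YX.
have C0 : C 0.
  (* A maximal C without 0 would be empty, hence smaller than {0}. *)
  apply: contrapT => nC0; apply: (maxC [set 0]%classic).
    split=> [|sub]; last by apply: nC0; apply: sub.
    move=> x Cx; exfalso; apply: nC0.
    by have := linC (-1) _ _ Cx Cx; rewrite scaleN1r addNr.
  by split=> [a x y /= -> ->|x ->//]; rewrite scaler0 addr0.
have subC : subspace C by split.
exists C; split=> // x; apply: contrapT => nx.
have nUx c : C c -> ~ U (x - c) by move=> Cc Uxc; apply: nx; exists c.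
(* Otherwise C + K x would be a larger candidate. *)
apply: (maxC [set y | exists2 c, C c & exists a, y = c + a *: x]%classic).
  split=> [c Cc|sub]; first by exists c => //; exists 0; rewrite scale0r addr0.
  have /nUx : C x.
    by apply: sub; exists 0 => //; exists 1; rewrite scale1r add0r.
  by rewrite subrr.
split=> [b y z [c Cc [a ->]] [e Ce [a' ->]]|y [c Cc [a ->]] Uy].
  exists (b *: c + e); first exact: linC.
  by exists (b * a + a'); rewrite scalerDr addrACA scalerA -scalerDl.
have [a0|a_neq0] := eqVneq a 0.
  by move: Uy; rewrite a0 scale0r addr0 => /(CU _ Cc).
exfalso; apply: (nUx (- a^-1 *: c)); first exact: subspaceZ.
have -> : x - - a^-1 *: c = a^-1 *: (c + a *: x).
  by rewrite scaleNr opprK scalerDr scalerA mulVf // scale1r addrC.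
exact: subspaceZ.
Qed.

(** Choose complements C of ker d and E of im d; the inverse sends y to the
    unique c in C for which y - d c lies in E. *)
Lemma generalized_inverse_exists (V W : lmodType K) (d : {linear V -> W}) :
  exists g : {linear W -> V}, forall x, d (g (d x)) = d x.
Proof.
have subker : subspace [set x | d x = 0].
  split=> [|a x y /= dx dy]; first exact: linear0.
  by rewrite linearP dx dy scaler0 addr0.
have subim : subspace [set y | exists x, y = d x].
  split=> [|a _ _ [x ->] [y ->]]; first by exists 0; rewrite linear0.
  by exists (a *: x + y); rewrite linearP.
have [C [subC C_ker C_tot]] := complement_exists subker.
have [E [subE E_im E_tot]] := complement_exists subim.
have [||y [Cy Ey]|g gE] :=
    @linear_of_relation W V (fun x y => C y /\ E (x - d y)).
- move=> x; have [e Ee [y xe]] := E_tot x; have [c Cc /= yc] := C_tot y.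
  exists c; split=> //; move: yc; rewrite linearB => /subr0_eq <-.
  by rewrite -xe opprB addrC subrK.
- move=> a x y x' y' [Cy Exy] [Cy' Exy'].
  split; first by case: subC => _; apply.
  rewrite linearP opprD addrACA -scalerBr.
  by case: subE => _; apply.
- apply: (C_ker _ Cy); apply/eqP; rewrite -oppr_eq0 -sub0r.
  apply/eqP/(E_im _ Ey).
  by exists (- y); rewrite sub0r linearN.
exists g => x; have [_ Ex] := (gE (d x) _).2 erefl.
apply/esym/subr0_eq/(E_im _ Ex).
by exists (x - g (d x)); rewrite linearB.
Qed.

Lemma sum_if_mem (V : nmodType) (I : eqType) (s r : seq I) (c : I -> V) :
    uniq s -> uniq r -> {subset s <= r} ->
  \sum_(k <- r) (if k \in s then c k else 0) = \sum_(k <- s) c k.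
Proof.
move=> us ur sr; rewrite -big_mkcond -big_filter; apply: perm_big.
apply: uniq_perm; rewrite ?filter_uniq // => k; rewrite mem_filter.
by case ks: (k \in s) => //=; apply: sr.
Qed.

Section Graded.
Variables (V : lmodType K) (gr : int -> set V).
Hypothesis gradV : grading gr.

Lemma grading_subspace k : subspace (gr k).
Proof. by case: gradV => /(_ k). Qed.

(** The universal property of the direct sum: a linear map may be prescribed
    freely on each homogeneous part. *)
Lemma linear_of_components (W : lmodType K) (f : int -> {linear V -> W}) :
  exists F : {linear V -> W}, forall k x, gr k x -> F x = f k x.
Proof.
have [_ decomp indep] := gradV.
pose rel x z := exists (s : seq int) (c : int -> V),
  [/\ uniq s, forall k, gr k (c k), x = \sum_(k <- s) c k
    & z = \sum_(k <- s) f k (c k)].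
have rel_lin a x y x' y' : rel x y -> rel x' y' ->
    rel (a *: x + x') (a *: y + y').
  move=> [s [c [us grc -> ->]]] [t [e [ut gre -> ->]]].
  pose r := undup (s ++ t).
  have sr : {subset s <= r} by move=> k; rewrite mem_undup mem_cat => ->.
  have tr : {subset t <= r} by move=> k; rewrite mem_undup mem_cat orbC => ->.
  (* Outside its list of degrees a decomposition carries arbitrary
     components, so they are cut off before the two are combined. *)
  exists r, (fun k => a *: (if k \in s then c k else 0) +
                      (if k \in t then e k else 0)).
  have ur : uniq r by apply: undup_uniq.
  split=> [//|k||].
  - have [gr0 lin] := grading_subspace k.
    by apply: lin; case: ifP.
  - by rewrite big_split -scaler_sumr /= !sum_if_mem.
  - rewrite -(sum_if_mem (fun k => f k (c k)) us ur sr).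
    rewrite -(sum_if_mem (fun k => f k (e k)) ut ur tr).
    rewrite scaler_sumr -big_split; apply: eq_bigr => k _ /=.
    by rewrite linearP; do 2!case: ifP => _; rewrite ?linear0.
have rel_hom k x : gr k x -> rel x (f k x).
  move=> grx; exists [:: k], (fun j => if j == k then x else 0).
  split=> [//|j||]; rewrite ?big_seq1 ?eqxx //.
  by case: eqP => [->//|_]; case: (grading_subspace j).
have rel_sum s c : (forall k, gr k (c k)) ->
    rel (\sum_(k <- s) c k) (\sum_(k <- s) f k (c k)).
  move=> grc; elim: s => [|k s IHs].
    rewrite !big_nil; exists [::], (fun=> 0); split; rewrite ?big_nil // => k.
    by case: (grading_subspace k).
  rewrite !big_cons -[c k]scale1r linearZ; apply: rel_lin => //.
  by apply: rel_hom.
have [x|//|z [s [c [us grc /esym c0 ->]]]|F FE] :=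
    @linear_of_relation V W rel.
- have [s [c [grc ->]]] := decomp x.
  by exists (\sum_(k <- s) f k (c k)); apply: rel_sum.
- rewrite big_seq big1 // => k ks.
  by rewrite (indep s c us grc c0 k ks) linear0.
by exists F => k x grx; apply/FE/rel_hom.
Qed.

Lemma eq_on_homogeneous (W : lmodType K) (F G : {linear V -> W}) :
  (forall k x, gr k x -> F x = G x) -> forall x, F x = G x.
Proof.
move=> FG x; have [_ decomp _] := gradV; have [s [c [grc ->]]] := decomp x.
by rewrite !linear_sum; apply: eq_bigr => k _; apply: (FG k).
Qed.

Lemma component_exists k : exists pr : {linear V -> V},
  [/\ forall x, gr k (pr x)
    & forall j x, gr j x -> pr x = if j == k then x else 0].
Proof.
have [pr prE] := linear_of_components
  (fun j => ((j == k)%:R : K) \*: (idfun : {linear V -> V})).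
have prE' j x : gr j x -> pr x = if j == k then x else 0.
  by move=> /prE-> /=; case: eqP; rewrite ?scale1r ?scale0r.
exists pr; split=> // x.
have [_ decomp _] := gradV; have [s [c [grc ->]]] := decomp x.
rewrite linear_sum; apply: subspace_sum; first exact: grading_subspace.
move=> j; rewrite (prE' j) //; case: eqP => [<-//|_].
by case: (grading_subspace k).
Qed.

(** An arbitrary generalized inverse g0 is made homogeneous by keeping, on the
    part of degree k, only the component of g0 in degree k - n; the identity
    d g d = d survives because d intertwines the component projections. *)
Lemma homogeneous_generalized_inverse (d : {linear V -> V}) n :
  homogeneous gr gr n d ->
  exists2 g : {linear V -> V}, homogeneous gr gr (- n) g &
    forall x, d (g (d x)) = d x.
Proof.
move=> d_hom; have [g0 g0E] := generalized_inverse_exists d.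
have [pr prE] := choice component_exists.
have [g gE] := linear_of_components (fun k => pr (k - n) \o g0).
exists g => [k x grx|]; first by rewrite (gE k x grx); exact: (prE (k - n)).1.
have d_pr k x : d (pr k x) = pr (k + n) (d x).
  apply: (@eq_on_homogeneous _ (d \o pr k) (pr (k + n) \o d)) => j y gry /=.
  rewrite ((prE k).2 j) // ((prE (k + n)).2 (j + n)); last exact: d_hom.
  by rewrite (inj_eq (addIr n)); case: eqP; rewrite ?linear0.
apply: (@eq_on_homogeneous _ (d \o g \o d) d) => k x grx /=.
rewrite (gE (k + n)) /=; last exact: d_hom.
rewrite addrK d_pr g0E ((prE (k + n)).2 (k + n)) ?eqxx //; exact: d_hom.
Qed.

End Graded.
End LinearAlgebra.

(** * A homotopy retract onto homology *)

(** The retract attached to g with d g d = d: on classes of cycles,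
    p x = [x - g d x] and i [z] = z - d g z. As d g d = d, the map p takes
    values in classes of cycles and i kills boundaries; moreover
    i p - 1 = - g d - d g + d g g d, which is d h + h d for h = g g d - g. *)
Section Retract.
Variables (K : fieldType) (A : lmodType K) (gr : int -> set A).
Hypothesis gradA : grading gr.
Variables (d g : {linear A -> A}).
Hypothesis dd : forall x, d (d x) = 0.
Hypothesis dgd : forall x, d (g (d x)) = d x.

Lemma homology_class_linear (dV : {linear A -> A}) a (z t : cycles dV) :
  homology_class (a *: z + t) = a *: homology_class z + homology_class t.
Proof. by rewrite homology_classD -homology_scaleE. Qed.

Fact proj_cycle x : x - g (d x) \in is_cycle d.
Proof. by rewrite inE linearB /= dgd subrr. Qed.

Definition retract_p x : homology d := homology_class (Cycle (proj_cycle x)).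

Fact retract_p_linear : linear retract_p.
Proof.
move=> a x y; rewrite /retract_p -homology_class_linear; congr homology_class.
by apply: val_inj; rewrite [RHS]linearP /= !linearP scalerDr addrACA.
Qed.

HB.instance Definition _ :=
  GRing.isLinear.Build K A (homology d) *:%R retract_p retract_p_linear.

Definition retract_i (c : homology d) : A :=
  val (repr c) - d (g (val (repr c))).

Lemma retract_iE z : retract_i (homology_class z) = val z - d (g (val z)).
Proof.
have /homology_classP[y yE] : homology_class (repr (homology_class z))
  = homology_class z by exact: homology_classK.
rewrite /retract_i; have -> : val (repr (homology_class z)) = d y + val z.
  by rewrite -yE subrK.
by rewrite !linearD /= dgd addrACA subrr add0r.
Qed.

Fact retract_i_linear : linear retract_i.
Proof.
move=> a b c; rewrite -(homology_classK b) -(homology_classK c).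
rewrite -homology_class_linear !retract_iE [val _]linearP /=.
by rewrite !linearP scalerDr addrACA.
Qed.

HB.instance Definition _ :=
  GRing.isLinear.Build K (homology d) A *:%R retract_i retract_i_linear.

Definition retract_h : {linear A -> A} := (g \o g \o d) \- g.

Lemma homology_class_boundary (dV : {linear A -> A}) (z : cycles dV) y :
  val z = dV y -> homology_class z = 0.
Proof.
move=> zy; transitivity (homology_class (0 : cycles dV)).
  by apply/homology_classP; exists y; rewrite [val 0]linear0 subr0.
by apply: (addrI (homology_class 0)); rewrite -homology_classD !addr0.
Qed.

Lemma cycle_valE (z : cycles d) : d (val z) = 0.
Proof. by apply/eqP; have := valP z; rewrite inE. Qed.

Lemma retract_pK c : retract_p (retract_i c) = c.
Proof.
rewrite -(homology_classK c) retract_iE; apply/homology_classP.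
set z := val (repr c); exists (- g z).
rewrite /= linearB dd subr0 cycle_valE linear0 subr0.
by rewrite addrAC subrr add0r linearN.
Qed.

Hypothesis d_hom : homogeneous gr gr (-1) d.
Hypothesis g_hom : homogeneous gr gr 1 g.

Lemma gd_hom k x : gr k x -> gr k (g (d x)).
Proof. by move=> /d_hom/g_hom; rewrite subrK. Qed.

Lemma dg_hom k x : gr k x -> gr k (d (g x)).
Proof. by move=> /g_hom/d_hom; rewrite addrK. Qed.

Lemma retract_p_chain : chain_map d \0 gr (homology_grading gr) retract_p.
Proof.
split=> [k x grx|x].
  exists (Cycle (proj_cycle x)) => //=; rewrite addr0.
  by apply: subspaceB => //; [apply: grading_subspace | apply: gd_hom].
by apply: (homology_class_boundary (y := x)); rewrite /= dd linear0 subr0.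
Qed.

Lemma retract_i_hom : homogeneous (homology_grading gr) gr 0 retract_i.
Proof.
move=> k _ [z grz ->]; rewrite retract_iE addr0.
by apply: subspaceB => //; [apply: grading_subspace | apply: dg_hom].
Qed.

Fact retract_i_commutes : commutes_with_d \0 d retract_i.
Proof. by move=> c; rewrite linear0 /retract_i linearB dd subr0 cycle_valE. Qed.

(** As i z is homologous to z, the map induced by i is the tautological
    identification of the homology of the zero differential. *)
Lemma retract_i_homology_map (z : cycles (\0 : {linear homology d -> _})) :
  homology_map retract_i_commutes (homology_class z) = val z.
Proof.
rewrite homology_mapE -[RHS]homology_classK; apply/homology_classP.
exists (- g (val (repr (val z)))).
by rewrite /= /retract_i addrAC subrr add0r linearN.
Qed.

Lemma retract_i_quasi :
  quasi_isomorphism (homology_grading gr) \0 gr d retract_i.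
Proof.
split; first exact: retract_i_hom.
exists retract_i_commutes.
have cyc (c : homology d) : c \in is_cycle (\0 : {linear homology d -> _}).
  by rewrite inE.
exists (fun c => homology_class (Cycle (cyc c))) => [c|c].
  rewrite -[c]homology_classK retract_i_homology_map; congr homology_class.
  exact: val_inj.
by rewrite retract_i_homology_map.
Qed.

Lemma retract_h_hom : homogeneous gr gr 1 retract_h.
Proof.
move=> k x grx /=; apply: subspaceB; first exact: grading_subspace.
  by apply: g_hom; apply: gd_hom.
exact: g_hom.
Qed.

Lemma retract_homotopy x :
  retract_i (retract_p x) - x = d (retract_h x) + retract_h (d x).
Proof.
rewrite retract_iE /= !linearB /= dd !linear0 sub0r.
by rewrite opprK addrAC [x - _]addrC addrK addrC [- d _ + _]addrC.
Qed.

Definition retract : homotopy_retract gr d :=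
  HomotopyRetract retract_p_chain retract_i_quasi retract_h_hom
    retract_homotopy.

End Retract.

(** * The ring of linear endomorphisms *)

Section Endomorphisms.
Variables (K : fieldType) (A : lmodType K).

(** Endomorphisms are encoded as a subtype of the functions, so that the
    module structure and the evaluation rules are inherited pointwise. *)
Definition is_linear : {pred A -> A} := [pred f | `[< linear f >]].

Fact is_linear_submod_closed : submod_closed is_linear.
Proof.
split=> [|a f g /asboolP linf /asboolP ling]; apply/asboolP => b x y.
  by rewrite scaler0 addr0.
rewrite !addrfctE !scalrfctE linf ling !scalerDr !scalerA (mulrC a b).
by rewrite addrACA.
Qed.

HB.instance Definition _ :=
  GRing.isSubmodClosed.Build K (A -> A) is_linear is_linear_submod_closed.

Record endo := Endo { endo_fun :> A -> A; _ : endo_fun \in is_linear }.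

HB.instance Definition _ := [isSub for endo_fun].
HB.instance Definition _ := [Choice of endo by <:].
HB.instance Definition _ := [SubChoice_isSubLmodule of endo by <:].

Lemma endo_linear (f : endo) : linear f.
Proof. by apply/asboolP; exact: (valP f). Qed.

HB.instance Definition _ (f : endo) :=
  GRing.isLinear.Build K A A *:%R (f : A -> A) (endo_linear f).

Lemma endo_ext (f g : endo) : (forall x, f x = g x) -> f = g.
Proof. by move=> fg; apply/val_inj/funext. Qed.

Fact linear_is_linear (f : {linear A -> A}) : (f : A -> A) \in is_linear.
Proof. by apply/asboolP => a x y; rewrite linearP. Qed.

Definition endo_of (f : {linear A -> A}) : endo := Endo (linear_is_linear f).

Fact id_is_linear : (id : A -> A) \in is_linear.
Proof. by apply/asboolP. Qed.

Fact comp_is_linear (f g : endo) : (f \o g : A -> A) \in is_linear.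
Proof. by apply/asboolP => a x y /=; rewrite !linearP. Qed.

Definition endo_one : endo := Endo id_is_linear.
Definition endo_mul (f g : endo) : endo := Endo (comp_is_linear f g).

Fact endo_mulA : associative endo_mul.
Proof. by move=> f g k; apply: endo_ext. Qed.
Fact endo_mul1 : left_id endo_one endo_mul.
Proof. by move=> f; apply: endo_ext. Qed.
Fact endo_mulr1 : right_id endo_one endo_mul.
Proof. by move=> f; apply: endo_ext. Qed.
Fact endo_mulDl : left_distributive endo_mul +%R.
Proof. by move=> f g k; apply: endo_ext. Qed.
Fact endo_mulDr : right_distributive endo_mul +%R.
Proof. by move=> f g k; apply: endo_ext => x /=; rewrite [LHS]linearD. Qed.

HB.instance Definition _ := GRing.Zmodule_isPzRing.Build endo
  endo_mulA endo_mul1 endo_mulr1 endo_mulDl endo_mulDr.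

Lemma endoM (f g : endo) x : (f * g) x = f (g x). Proof. by []. Qed.
Lemma endo0 x : (0 : endo) x = 0. Proof. by []. Qed.
Lemma endoD (f g : endo) x : (f + g) x = f x + g x. Proof. by []. Qed.
Lemma endoZ a (f : endo) x : (a *: f) x = a *: f x. Proof. by []. Qed.

Lemma endo_sum (I : Type) (r : seq I) (P : pred I) (F : I -> endo) x :
  (\sum_(i <- r | P i) F i) x = \sum_(i <- r | P i) F i x.
Proof.
exact: (big_morph (fun f : endo => f x) (fun f g => endoD f g x) (endo0 x)).
Qed.


Lemma endo_scalerAl a (f g : endo) : a *: (f * g) = (a *: f) * g.
Proof. by apply: endo_ext. Qed.

Lemma endo_scalerAr a (f g : endo) : a *: (f * g) = f * (a *: g).
Proof. by apply: endo_ext => x; rewrite endoM endoZ endoM endoZ linearZ. Qed.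

End Endomorphisms.

(** * Formal power series over the endomorphism ring *)

Section Series.
Variables (K : fieldType) (A : lmodType K).

(** A new name keeps the Cauchy product apart from the pointwise product that
    functions into a ring carry. *)
Definition series := nat -> endo A.

HB.instance Definition _ := GRing.Lmodule.copy series (nat -> endo A).

Implicit Types F G H : series.

Definition cseries (f : endo A) : series := fun n => if n == 0%N then f else 0.

Definition smul F G : series := fun n => \sum_(i < n.+1) F i * G (n - i)%N.

Lemma series_ext F G : (forall n, F n = G n) -> F = G.
Proof. by move=> FG; apply/funext. Qed.

Lemma scoef_add F G n : (F + G) n = F n + G n. Proof. by []. Qed.
Lemma scoef_opp F n : (- F) n = - F n. Proof. by []. Qed.
Lemma scoef_scale a F n : (a *: F) n = a *: F n. Proof. by []. Qed.

Lemma smulE_rev F G n : smul F G n = \sum_(i < n.+1) F (n - i)%N * G i.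
Proof.
rewrite /smul (reindex_inj rev_ord_inj) /=; apply: eq_bigr => i _.
by rewrite subSS subKn // -ltnS.
Qed.

Fact smulA : associative smul.
Proof.
move=> F G H; apply: series_ext => n; rewrite [RHS]smulE_rev /smul.
pose t (i j : nat) := F i * (G (n - i - j)%N * H j).
have -> : \sum_(i < n.+1) F i * smul G H (n - i)%N =
          \sum_(i < n.+1) \sum_(j < n.+1 | (i + j <= n)%N) t i j.
  apply: eq_bigr => i _; rewrite smulE_rev mulr_sumr.
  rewrite (big_ord_widen_cond n.+1 predT (fun j => t i j)) ?ltnS ?leq_subr //.
  by apply: eq_bigl => j /=; rewrite ltnS leq_subRL // -ltnS.
rewrite (exchange_big_dep xpredT) //=; apply: eq_bigr => j _.
rewrite mulr_suml (big_ord_widen_cond n.+1 predT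
  (fun i => F i * G (n - j - i)%N * H j)) ?ltnS ?leq_subr //.
apply: eq_big => i /=; first by rewrite ltnS leq_subRL ?(addnC i) // -ltnS.
by move=> _; rewrite /t mulrA subnAC.
Qed.

Fact smul1 : left_id (cseries 1) smul.
Proof.
move=> F; apply: series_ext => n; rewrite /smul big_ord_recl mul1r subn0.
by rewrite big1 ?addr0 // => i _; rewrite mul0r.
Qed.

Fact smulr1 : right_id (cseries 1) smul.
Proof.
move=> F; apply: series_ext => n; rewrite smulE_rev big_ord_recl mulr1 subn0.
by rewrite big1 ?addr0 // => i _; rewrite mulr0.
Qed.

Fact smulDl : left_distributive smul +%R.
Proof.
move=> F G H; apply: series_ext => n; rewrite scoef_add -big_split /=.
by apply: eq_bigr => i _; rewrite scoef_add mulrDl.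
Qed.

Fact smulDr : right_distributive smul +%R.
Proof.
move=> F G H; apply: series_ext => n; rewrite scoef_add -big_split /=.
by apply: eq_bigr => i _; rewrite scoef_add mulrDr.
Qed.

HB.instance Definition _ := GRing.Zmodule_isPzRing.Build series
  smulA smul1 smulr1 smulDl smulDr.

Lemma scoef_mul F G n : (F * G) n = \sum_(i < n.+1) F i * G (n - i)%N.
Proof. by []. Qed.

Lemma scoef_mul0 F G : (F * G) 0%N = F 0%N * G 0%N.
Proof. by rewrite scoef_mul big_ord1. Qed.

Lemma scoef_cst_mul f F n : (cseries f * F) n = f * F n.
Proof.
rewrite scoef_mul big_ord_recl subn0 big1 ?addr0 // => i _.
by rewrite mul0r.
Qed.

Lemma scoef_mul_cst f F n : (F * cseries f) n = F n * f.
Proof.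
rewrite [LHS]smulE_rev big_ord_recl subn0 big1 ?addr0 // => i _.
by rewrite mulr0.
Qed.

Lemma cseriesM f g : cseries (f * g) = cseries f * cseries g.
Proof.
apply: series_ext => n; rewrite scoef_cst_mul /cseries.
by case: eqP; rewrite ?mulr0.
Qed.

Lemma cseriesD f g : cseries (f + g) = cseries f + cseries g.
Proof.
apply: series_ext => n; rewrite scoef_add /cseries.
by case: eqP; rewrite ?addr0.
Qed.

Lemma cseriesN f : cseries (- f) = - cseries f.
Proof.
apply: series_ext => n; rewrite scoef_opp /cseries.
by case: eqP; rewrite ?oppr0.
Qed.

Lemma cseries0 : cseries 0 = 0.
Proof. by apply: series_ext => n; rewrite /cseries if_same. Qed.

Lemma cseries1 : cseries 1 = 1. Proof. by []. Qed.

Lemma scoef_sum (I : Type) (r : seq I) (P : pred I) (F : I -> series) n :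
  (\sum_(i <- r | P i) F i) n = \sum_(i <- r | P i) F i n.
Proof.
exact: (big_morph (fun F : series => F n) (fun F G => scoef_add F G n)).
Qed.

Lemma series_scalerAl a F G : a *: (F * G) = (a *: F) * G.
Proof.
apply: series_ext => n; rewrite scoef_scale !scoef_mul scaler_sumr.
by apply: eq_bigr => i _; rewrite scoef_scale endo_scalerAl.
Qed.

Lemma series_scalerAr a F G : a *: (F * G) = F * (a *: G).
Proof.
apply: series_ext => n; rewrite scoef_scale !scoef_mul scaler_sumr.
by apply: eq_bigr => i _; rewrite scoef_scale endo_scalerAr.
Qed.

(** Membership in z^n S, the z-adic filtration. *)
Definition vanish n F := forall m, (m < n)%N -> F m = 0.

Lemma vanish1 F : F 0%N = 0 -> vanish 1 F. Proof. by move=> F0 [|m]. Qed.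

Lemma vanishW m n F : (m <= n)%N -> vanish n F -> vanish m F.
Proof. by move=> mn Fn k km; apply: Fn; apply: leq_trans mn. Qed.

Lemma vanishD n F G : vanish n F -> vanish n G -> vanish n (F + G).
Proof. by move=> Fn Gn m mn; rewrite scoef_add Fn ?Gn ?addr0. Qed.

Lemma vanishN n F : vanish n F -> vanish n (- F).
Proof. by move=> Fn m mn; rewrite scoef_opp Fn ?oppr0. Qed.

Lemma vanishB n F G : vanish n F -> vanish n G -> vanish n (F - G).
Proof. by move=> Fn /vanishN; apply: vanishD. Qed.

Lemma vanishZ n a F : vanish n F -> vanish n (a *: F).
Proof. by move=> Fn m mn; rewrite scoef_scale Fn ?scaler0. Qed.

Lemma vanish_sum n (I : Type) (r : seq I) (P : pred I) (F : I -> series) :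
  (forall i, P i -> vanish n (F i)) -> vanish n (\sum_(i <- r | P i) F i).
Proof.
by move=> Fn m mn; rewrite scoef_sum big1 // => i Pi; apply: Fn.
Qed.

Lemma vanishM m n F G : vanish m F -> vanish n G -> vanish (m + n) (F * G).
Proof.
move=> Fm Gn k kmn; rewrite scoef_mul big1 // => i _.
have [im|mi] := ltnP i m; first by rewrite Fm ?mul0r.
rewrite Gn ?mulr0 // ltn_subLR; last by rewrite -ltnS.
by rewrite (leq_trans kmn) // leq_add2r.
Qed.

Lemma vanishMl n F G : vanish n G -> vanish n (F * G).
Proof. by move=> Gn; apply: (@vanishM 0) Gn. Qed.

Lemma vanishMr n F G : vanish n F -> vanish n (F * G).
Proof. by move=> Fn; rewrite -[n]addn0; apply: vanishM. Qed.

Lemma vanishX n F : F 0%N = 0 -> vanish n (F ^+ n).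
Proof.
move=> F0; elim: n => [//|n IHn]; rewrite exprS -add1n.
by apply: vanishM => //; apply: vanish1.
Qed.

Lemma vanish_eq0 F : (forall n, vanish n F) -> F = 0.
Proof. by move=> F0; apply: series_ext => n; apply: (F0 n.+1). Qed.

(** Iterating F = T F places F in every step of the filtration, since T^n lies
    in the n-th one. *)
Lemma series_contract_l (T F : series) : T 0%N = 0 -> F = T * F -> F = 0.
Proof.
move=> T0 FT; apply: vanish_eq0 => n.
have -> : F = T ^+ n * F.
  by elim: n => [|n IHn]; rewrite ?mul1r // exprSr -mulrA -FT.
by apply: vanishMr; apply: vanishX.
Qed.

Lemma series_contract_r (T F : series) : T 0%N = 0 -> F = F * T -> F = 0.
Proof.
move=> T0 FT; apply: vanish_eq0 => n.
have -> : F = F * T ^+ n.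
  by elim: n => [|n IHn]; rewrite ?mulr1 // exprS mulrA -FT.
by apply: vanishMl; apply: vanishX.
Qed.

(** The Picard iterates from 0 converge z-adically. The last clause transfers
    to the fixed point any coefficientwise property that T preserves; it is
    used to control degrees. *)
Lemma contraction_fixpoint (T : series -> series) :
    (forall n F G, vanish n (F - G) -> vanish n.+1 (T F - T G)) ->
  exists2 F, T F = F &
    forall P : nat -> endo A -> Prop, (forall n, P n 0) ->
      (forall G, (forall n, P n (G n)) -> forall n, P n (T G n)) ->
      forall n, P n (F n).
Proof.
move=> Tc; pose u n := iter n T 0.
have uc n : vanish n (u n.+1 - u n) by elim: n => [//|n IHn]; apply: Tc.
have uS m n : (n <= m)%N -> vanish n (u m - u n).
  elim: m => [|m IHm]; first by rewrite leqn0 => /eqP->.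
  rewrite leq_eqVlt => /predU1P[->|nm]; first by rewrite subrr.
  rewrite -(subrK (u m) (u m.+1)) -addrA; apply: vanishD; last exact: IHm.
  by apply: vanishW (uc m).
pose F : series := fun n => u n.+1 n.
have uF n : vanish n (F - u n).
  move=> m mn; rewrite scoef_add scoef_opp; apply/eqP; rewrite subr_eq0 eq_sym.
  by rewrite -subr_eq0; apply/eqP; apply: (uS n m.+1 mn).
exists F => [|P P0 PT n].
  apply/eqP; rewrite -subr_eq0; apply/eqP/vanish_eq0 => n.
  apply: (@vanishW _ n.+1) => //.
  have -> : T F - F = (T F - u n.+1) - (F - u n.+1).
    by rewrite opprB addrA subrK.
  by apply: vanishB; [apply: Tc | apply: uF].
suff Pu k : forall m, P m (u k m) by apply: Pu.
by elim: k => [//|k IHk]; apply: PT.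
Qed.

End Series.

(** * Exponential and logarithm *)

Section Exponential.
Variables (K : fieldType) (A : lmodType K).
Implicit Types F G : series A.

Definition exps F : series A :=
  fun n => \sum_(k < n.+1) (k`!%:R^-1 : K) *: (F ^+ k) n.

Lemma exps_coef0 F : exps F 0%N = 1.
Proof. by rewrite /exps big_ord1 expr0 fact0 invr1 scale1r. Qed.

(** Polynomials in F approximating its exponential: they lie in the ring
    generated by F, where the binomial theorem applies. *)
Definition exp_trunc N F : series A :=
  \sum_(k < N) (k`!%:R^-1 : K) *: F ^+ k.

Lemma exps_trunc N F : F 0%N = 0 -> vanish N (exps F - exp_trunc N F).
Proof.
move=> F0 n nN; rewrite scoef_add scoef_opp /exp_trunc scoef_sum /exps.
rewrite (big_ord_widen N (fun k => (k`!%:R^-1 : K) *: (F ^+ k) n)) //.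
rewrite big_mkcond -sumrB big1 // => k _; rewrite scoef_scale.
by case: ltnP => [|nk]; rewrite ?subrr // vanishX // scaler0 subrr.
Qed.

Lemma sum_triangle (V : zmodType) (f : nat -> nat -> V) N :
  \sum_(i < N) \sum_(j < N - i) f i j =
  \sum_(n < N) \sum_(i < n.+1) f i (n - i)%N.
Proof.
elim: N => [|N IHN]; first by rewrite !big_ord0.
rewrite [RHS]big_ord_recr /= -IHN [X in _ = _ + X]big_ord_recr /= addrA.
rewrite -big_split /= big_ord_recr /= subSnn big_ord1 subnn; congr (_ + _).
by apply: eq_bigr => i _; rewrite subSn ?(ltnW (ltn_ord i)) // big_ord_recr.
Qed.

Hypothesis charK0 : [pchar K] =i pred0.

Lemma fact_neq0 n : n`!%:R != 0 :> K.
Proof. by rewrite ((pcharf0P K).1 charK0) -lt0n fact_gt0. Qed.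

(** In the product of the two truncations the terms of total degree m <= N in
    F add up to (F - F)^m / m!, and all others lie in z^(N+1) S. *)
Lemma exp_trunc_mulN N F : F 0%N = 0 ->
  vanish N.+1 (exp_trunc N.+1 F * exp_trunc N.+1 (- F) - 1).
Proof.
move=> F0.
pose t i j : series A := (i`!%:R^-1 / j`!%:R) *: (F ^+ i * (- F) ^+ j).
have -> : exp_trunc N.+1 F * exp_trunc N.+1 (- F) =
    \sum_(i < N.+1) \sum_(j < N.+1) t i j.
  rewrite mulr_suml; apply: eq_bigr => i _; rewrite mulr_sumr.
  apply: eq_bigr => j _.
  by rewrite /t -series_scalerAl -series_scalerAr scalerA.
have -> : \sum_(i < N.+1) \sum_(j < N.+1) t i j =
    \sum_(i < N.+1) \sum_(j < N.+1 - i) t i j +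
    \sum_(i < N.+1) \sum_(j < N.+1 | (N < i + j)%N) t i j.
  rewrite -big_split; apply: eq_bigr => i _ /=.
  rewrite (bigID (fun j : 'I_N.+1 => (i + j <= N)%N)) /=.
  congr (_ + _); last first.
    by apply: eq_bigl => j; rewrite ltnNge.
  rewrite (big_ord_widen N.+1 (t i)) ?leq_subr //.
  by apply: eq_bigl => j; rewrite ltn_subRL.
rewrite addrAC; apply: vanishD; last first.
  apply: vanish_sum => i _; apply: vanish_sum => j Nij; apply: vanishZ.
  apply: vanishW Nij _; apply: vanishM; apply: vanishX => //.
  by rewrite scoef_opp F0 oppr0.
suff -> : \sum_(i < N.+1) \sum_(j < N.+1 - i) t i j = 1.
  by rewrite subrr => m _.
rewrite sum_triangle big_ord_recl big_ord1 subnn /t fact0 invr1 mulr1 scale1r.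
rewrite mulr1 big1 ?addr0 // => n _.
transitivity (((lift ord0 n)`!%:R^-1 : K) *: (F - F) ^+ (lift ord0 n));
  last by rewrite subrr expr0n scaler0.
set m : nat := lift ord0 n.
rewrite addrC exprDn_comm; last by apply: commr_sym; apply: commrN.
rewrite scaler_sumr; apply: eq_bigr => i _.
have im : (i <= m)%N by rewrite -ltnS.
rewrite commrX; last by apply: commr_sym; apply: commrX; apply: commrN.
rewrite -scaler_nat scalerA; congr (_ *: _).
have := fact_neq0 m; rewrite -(bin_fact im) !natrM !mulf_eq0 !negb_or.
by case/and3P=> C0 i0 mi0; field; apply/and3P.
Qed.

Lemma exps_mulN F : F 0%N = 0 -> exps F * exps (- F) = 1.
Proof.
move=> F0; have NF0 : (- F) 0%N = 0 by rewrite scoef_opp F0 oppr0.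
apply/eqP; rewrite -subr_eq0; apply/eqP/vanish_eq0 => N.
apply: (@vanishW _ _ _ N.+1) => //.
have -> : exps F * exps (- F) - 1 =
    (exps F - exp_trunc N.+1 F) * exps (- F) +
    (exp_trunc N.+1 F * (exps (- F) - exp_trunc N.+1 (- F)) +
    (exp_trunc N.+1 F * exp_trunc N.+1 (- F) - 1)).
  by rewrite mulrBl mulrBr addrA subrKA addrA subrK.
apply: vanishD; first by apply: vanishMr; apply: exps_trunc.
by apply: vanishD; [apply: vanishMl; apply: exps_trunc|apply: exp_trunc_mulN].
Qed.

Lemma exps_mulV F : F 0%N = 0 -> exps (- F) * exps F = 1.
Proof.
by move=> F0; rewrite -{2}[F]opprK exps_mulN // scoef_opp F0 oppr0.
Qed.

Lemma vanish_expB n k F G : F 0%N = 0 -> G 0%N = 0 ->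
  vanish n (F - G) -> vanish (n + k) (F ^+ k.+1 - G ^+ k.+1).
Proof.
move=> F0 G0 FG; elim: k => [|k IHk]; first by rewrite addn0.
have -> : F ^+ k.+2 - G ^+ k.+2 =
    F * (F ^+ k.+1 - G ^+ k.+1) + (F - G) * G ^+ k.+1.
  by rewrite mulrBr mulrBl -!exprS addrA subrK.
apply: vanishD; last by apply: vanishM => //; apply: vanishX.
by rewrite addnS -add1n; apply: vanishM => //; apply: vanish1.
Qed.

(** The nonlinear part of the exponential gains one order: it is this that
    makes the equation exp F = Phi a contraction. *)
Lemma vanish_expsB n F G : F 0%N = 0 -> G 0%N = 0 ->
  vanish n (F - G) -> vanish n.+1 ((exps F - F) - (exps G - G)).
Proof.
move=> F0 G0 FG.
have trE (H : series A) : exp_trunc n.+2 H =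
    1 + H + \sum_(k < n) (k.+2`!%:R^-1 : K) *: H ^+ k.+2.
  by rewrite /exp_trunc 2!big_ord_recl /= !fact0 invr1 !scale1r addrA.
have -> : (exps F - F) - (exps G - G) =
    (exps F - exp_trunc n.+2 F) - (exps G - exp_trunc n.+2 G) +
    \sum_(k < n) (k.+2`!%:R^-1 : K) *: (F ^+ k.+2 - G ^+ k.+2).
  under eq_bigr do rewrite scalerBr.
  have sub3 (x y z : series A) : x - (1 + y + z) = (x - y - 1) - z.
    by rewrite !opprD (addrC (- 1)) !addrA.
  have subB (x y z t : series A) : (x - y) - (z - t) = (x - z) - (y - t).
    by rewrite [- (z - t)]opprD addrACA -opprD.
  by rewrite sumrB !trE !sub3 [in RHS]subB subrK [RHS]subB subrr subr0.
apply: vanishD.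
  by apply: (@vanishW _ _ _ n.+2) => //; apply: vanishB; apply: exps_trunc.
apply: vanish_sum => k _; apply: vanishZ.
apply: (vanishW _ (vanish_expB (k := k.+1) F0 G0 FG)).
by rewrite addnS ltnS leq_addr.
Qed.

Definition drop_const F : series A := fun n => if n == 0%N then 0 else F n.

(** The logarithm solves F = F + (Phi - exp F). Constant terms are dropped
    inside this map because the truncations defining exp converge only on
    series without one; the solution has none, its constant term being 1 - 1. *)
Lemma log_exists (Phi : series A) : Phi 0%N = 1 ->
  exists F, [/\ F 0%N = 0, exps F = Phi &
    forall P : nat -> endo A -> Prop, (forall n, P n 0) ->
      (forall G, (forall n, P n (G n)) ->
         forall n, P n ((drop_const G + (Phi - exps (drop_const G))) n)) ->
      forall n, P n (F n)].
Proof.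
move=> Phi0.
have [n F G FG|F FE FP] := contraction_fixpoint
    (T := fun F : series A => drop_const F + (Phi - exps (drop_const F))).
  rewrite opprD addrACA [- (Phi - _)]opprB [X in _ + X]addrC subrKA.
  have -> : drop_const F - drop_const G +
     (exps (drop_const G) - exps (drop_const F)) =
     exps (drop_const G) - drop_const G - (exps (drop_const F) - drop_const F).
    by rewrite [- (exps _ - _)]opprD [RHS]addrACA -opprD opprB addrC.
  apply: vanish_expsB => // -[|m] mn; first by rewrite scoef_add subrr.
  by have := vanishN FG; rewrite opprB => /(_ m.+1 mn).
have F0 : F 0%N = 0.
  by rewrite -FE scoef_add add0r scoef_add scoef_opp Phi0 exps_coef0 subrr.
exists F; split => //.
have dF : drop_const F = F.
  by apply: series_ext => n; rewrite /drop_const; case: eqP => // ->.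
have /addrI/eqP : F + (Phi - exps F) = F + 0 by rewrite addr0 -{1 2}dF FE.
by rewrite subr_eq0 => /eqP.
Qed.

End Exponential.

(** * Homological perturbation in the series ring *)

(** Here iota and varpi stand for (1 - h delta)^-1 pi and pi (1 - delta h)^-1;
    they enter through their fixed-point equations. *)
Section Perturbation.
Variables (K : fieldType) (A : lmodType K).
Variables d h pi delta : series A.
Hypothesis dd : d * d = 0.
Hypothesis homotopy : pi - 1 = d * h + h * d.
Hypothesis d_pi : d * pi = 0.
Hypothesis pi_d : pi * d = 0.
Hypothesis delta0 : delta 0%N = 0.
Let D := d + delta.
Hypothesis DD : D * D = 0.

Lemma perturbation_d : delta * d = - (D * delta).
Proof.
have -> : delta * d = D * d by rewrite mulrDl dd add0r.
by apply/eqP; rewrite -addr_eq0 -mulrDr DD.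
Qed.

Lemma d_perturbation : d * delta = - (delta * D).
Proof.
have -> : d * delta = d * D by rewrite mulrDr dd add0r.
by apply/eqP; rewrite -addr_eq0 -mulrDl DD.
Qed.

Variable iota : series A.
Hypothesis iotaE : iota = pi + h * delta * iota.

Lemma scoef0_hdelta : (h * delta) 0%N = 0.
Proof. by rewrite scoef_mul0 delta0 mulr0. Qed.

Lemma scoef0_deltah : (delta * h) 0%N = 0.
Proof. by rewrite scoef_mul0 delta0 mul0r. Qed.

Lemma perturbed_inclusion_d : iota * d = 0.
Proof.
apply: (series_contract_l scoef0_hdelta).
by rewrite {1}iotaE mulrDl pi_d add0r mulrA.
Qed.

(** Using the homotopy relation in d h delta iota, and d delta = - delta D,
    one finds that D iota is a fixed point of multiplication by h delta. *)
Lemma perturbed_inclusion_cycle : pi * delta * iota = 0 -> D * iota = 0.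
Proof.
move=> degen; apply: (series_contract_l scoef0_hdelta).
have diota : d * iota = - (delta * iota) - h * (d * delta * iota).
  rewrite {1}iotaE mulrDr d_pi add0r !mulrA.
  have -> : d * h = pi - 1 - h * d by rewrite homotopy addrK.
  by rewrite !mulrBl degen mul1r sub0r.
transitivity (- (h * (d * delta * iota))).
  by rewrite mulrDl diota addrAC addNr add0r.
by rewrite d_perturbation mulNr mulrN opprK !mulrA.
Qed.

(** iota corrected by the null-homotopic map D (- h) + (- h) d, the correction
    that makes the constant term 1. *)
Definition perturbation_iso := iota - D * h - h * d.

Lemma perturbation_iso_intertwines : pi * delta * iota = 0 ->
  D * perturbation_iso = perturbation_iso * d.
Proof.
move=> degen; rewrite /perturbation_iso !mulrBr !mulrBl.
rewrite perturbed_inclusion_cycle // perturbed_inclusion_d.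
by rewrite !mulrA DD mul0r -!mulrA dd !mulr0 !subr0 mulrA.
Qed.

Lemma perturbation_iso_coef0 : perturbation_iso 0%N = 1.
Proof.
have one_split : 1 = pi - d * h - h * d.
  by rewrite -addrA -opprD -homotopy opprB addrC subrK.
have -> : (1 : endo A) = (pi - d * h - h * d) 0%N by rewrite -one_split.
rewrite /perturbation_iso /D iotaE.
rewrite !(scoef_add, scoef_opp, scoef_mul0) delta0.
by rewrite mulr0 mul0r !addr0.
Qed.

Variable varpi : series A.
Hypothesis varpiE : varpi = pi + varpi * (delta * h).

(** The reason is that (1 - delta h)^-1 delta = delta (1 - h delta)^-1. *)
Lemma transferred_differential_sym : varpi * delta * pi = pi * delta * iota.
Proof.
have pi_iota : pi = iota - h * delta * iota by rewrite {1}iotaE addrK.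
have pi_varpi : pi = varpi - varpi * (delta * h) by rewrite {1}varpiE addrK.
transitivity (varpi * delta * iota - varpi * delta * h * delta * iota).
  by rewrite pi_iota mulrBr !mulrA.
by rewrite pi_varpi !mulrBl !mulrA.
Qed.

Hypothesis pi_idem : pi * pi = pi.

(** Both sides solve X = beta + X delta h with beta = varpi delta pi, and
    delta h has no constant term. *)
Lemma perturbed_projection_chain :
  varpi * D = varpi * delta * pi * varpi.
Proof.
set beta := varpi * delta * pi.
apply/eqP; rewrite -subr_eq0; apply/eqP.
apply: (series_contract_r scoef0_deltah).
have betaE : beta * varpi = beta + beta * varpi * (delta * h).
  by rewrite {1}varpiE mulrDr /beta -[_ * pi * pi]mulrA pi_idem !mulrA.
suff DE : varpi * D = beta + varpi * D * (delta * h).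
  by rewrite mulrBl {1}betaE {1}DE opprD addrACA subrr add0r.
have varpid : varpi * d = beta - varpi * delta - varpi * (delta * d) * h.
  rewrite {1}varpiE mulrDl pi_d add0r -!mulrA.
  have -> : h * d = pi - 1 - d * h by rewrite homotopy addrAC subrr add0r.
  by rewrite !mulrBr mulr1 /beta !mulrA.
transitivity (beta - varpi * (delta * d) * h).
  by rewrite mulrDr varpid addrAC subrK.
by rewrite perturbation_d mulrN mulNr opprK !mulrA.
Qed.

(** A chain isomorphism E from d to D yields the cycle E pi. Its image u =
    varpi E pi has constant term pi and is killed by beta, whence beta = beta
    (pi - u), where pi - u has no constant term. *)
Lemma degeneration_of_intertwiner (E : series A) :
  E 0%N = 1 -> D * E = E * d -> pi * delta * iota = 0.
Proof.
move=> E0 DE; rewrite -transferred_differential_sym.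
set beta := varpi * delta * pi.
have beta_u : beta * (varpi * E * pi) = 0.
  rewrite !mulrA -perturbed_projection_chain -(mulrA varpi) DE.
  by rewrite mulrA -mulrA d_pi mulr0.
have varpi0 : varpi 0%N = pi 0%N.
  by rewrite varpiE scoef_add scoef_mul0 scoef0_deltah mulr0 addr0.
apply: (@series_contract_r _ _ (pi - varpi * E * pi)).
  rewrite scoef_add scoef_opp !scoef_mul0 E0 varpi0 mulr1 -scoef_mul0 pi_idem.
  by rewrite subrr.
by rewrite mulrBr beta_u subr0 -[RHS]mulrA pi_idem.
Qed.

End Perturbation.

(** * Zigzag sums as coefficients of a geometric series *)

Lemma sum_tuple_cons (V : nmodType) (T : finType) k (P : pred (seq T))
    (F : seq T -> V) :
  \sum_(t : k.+1.-tuple T | P t) F t =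
  \sum_(a : T) \sum_(t : k.-tuple T | P (a :: t)) F (a :: t).
Proof.
rewrite pair_big_dep /=.
rewrite (reindex (fun p : T * k.-tuple T => [tuple of p.1 :: p.2])) //.
exists (fun t => (thead t, [tuple of behead t])) => [[a t] _|t _] /=.
  by congr pair; apply: val_inj.
by rewrite [RHS]tuple_eta; apply: val_inj.
Qed.

Lemma sum_tuple_nil (V : nmodType) (T : finType) (P : pred (seq T))
    (F : seq T -> V) :
  \sum_(t : 0.-tuple T | P t) F t = if P [::] then F [::] else 0.
Proof.
rewrite big_mkcond (big_pred1 [tuple]) // => t.
by rewrite (tuple0 t) /= eqxx.
Qed.

Section Zigzags.
Variables (K : fieldType) (A : lmodType K).
Variables (h : endo A) (delta : series A) (f : nat -> A -> A).
Hypothesis delta0 : delta 0%N = 0.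
Hypothesis f_delta : forall n x, (0 < n)%N -> f n x = delta n x.

(** Its coefficient of z^n adds up the zigzags Delta_(i_0) h ... h Delta_(i_k)
    with i_0 + ... + i_k = n and all indices positive. *)
Definition word k : series A := (delta * cseries h) ^+ k * delta.

Lemma scoef_wordS k n :
  word k.+1 n = \sum_(i < n.+1) delta i * (h * word k (n - i)%N).
Proof.
rewrite /word exprS -!mulrA scoef_mul; apply: eq_bigr => i _.
by rewrite scoef_cst_mul.
Qed.

(** The bound N on the parts is independent of n so that the induction can
    remove the first part, which lowers n. *)
Lemma zigzag_sum N k n x : (n < N)%N ->
  \sum_(t : k.+1.-tuple 'I_N |
      all (leq 1) (map val t) && (sumn (map val t) == n))
    zigzag f h (map val t) x = word k n x.
Proof.
elim: k n => [|k IHk] n nN.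
  rewrite (sum_tuple_cons 0
    (fun s : seq 'I_N => all (leq 1) (map val s) && (sumn (map val s) == n))
    (fun s => zigzag f h (map val s) x)) /word mul1r.
  under eq_bigr do rewrite (sum_tuple_nil
    (fun s => all (leq 1) (map val (_ :: s)) && (sumn (map val (_ :: s)) == n))
    (fun s => zigzag f h (map val (_ :: s)) x)).
  rewrite (bigD1 (Ordinal nN)) //= addn0 eqxx !andbT big1 ?addr0.
    by case: posnP => [->|n0]; [rewrite delta0 | rewrite f_delta].
  by move=> i; rewrite addn0 -val_eqE /= => /negbTE->; rewrite andbF.
rewrite (sum_tuple_cons k.+1
    (fun s : seq 'I_N => all (leq 1) (map val s) && (sumn (map val s) == n))
    (fun s => zigzag f h (map val s) x)) scoef_wordS endo_sum.
rewrite (big_ord_widen N (fun i => (delta i * (h * word k (n - i)%N)) x)) //.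
rewrite [RHS]big_mkcond /=; apply: eq_bigr => i _; rewrite ltnS.
have [i0|i0] /= := posnP i.
  by rewrite i0 big_pred0 // delta0 leq0n.
have [i_n|n_i] := leqP i n; last first.
  rewrite big_pred0 // => t; apply/negbTE; rewrite negb_and orbC.
  by rewrite neq_ltn (leq_trans n_i) ?leq_addr ?orbT.
rewrite -(IHk _ (leq_ltn_trans (leq_subr i n) nN)) !linear_sum /=.
apply: eq_big => [t|t _].
  by rewrite -[in RHS](eqn_add2l i) subnKC.
by case/tupleP: t => b t /=; rewrite f_delta.
Qed.

(** Unrolling the fixed-point equation n times leaves a remainder in
    z^(n+1) S. *)
Lemma zigzag_total_sum (pi iota : series A) n x :
  iota = pi + cseries h * delta * iota ->
  (delta * iota) n x = \sum_(k < n) (word k * pi) n x.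
Proof.
move=> iotaE.
have iotaS m : delta * iota =
    \sum_(k < m) word k * pi + (delta * cseries h) ^+ m * (delta * iota).
  elim: m => [|m IHm]; first by rewrite big_ord0 add0r mul1r.
  rewrite {1}IHm {1}iotaE !mulrDr big_ord_recr /= -addrA; congr (_ + (_ + _)).
    by rewrite /word !mulrA.
  by rewrite exprSr !mulrA.
have dh0 : (delta * cseries h) 0%N = 0 by rewrite scoef_mul0 delta0 mul0r.
rewrite (iotaS n) scoef_add scoef_sum endoD endo_sum.
have rest_vanish : vanish (n + 1) ((delta * cseries h) ^+ n * (delta * iota)).
  apply: vanishM; first exact: vanishX.
  by apply: vanishMr; apply: vanish1.
by rewrite (rest_vanish n) ?addn1 // endo0 addr0.
Qed.

End Zigzags.

(** * Degrees, coefficients, and the two implications *)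

Section Weights.
Variables (K : fieldType) (A : lmodType K) (gr : int -> set A).
Hypothesis gradA : grading gr.
Implicit Types F G : series A.

(** Homogeneity of degree c when z is given degree -2; for this grading D has
    degree -1. *)
Definition weight (c : int) F :=
  forall n : nat, homogeneous gr gr (2 * n%:Z + c) (F n).

Lemma homogeneous0 (n : int) : homogeneous gr gr n (0 : endo A).
Proof. by move=> k x _; case: (grading_subspace gradA (k + n)). Qed.

Lemma weight_cseries c (f : endo A) :
  homogeneous gr gr c f -> weight c (cseries f).
Proof.
by move=> f_hom [|n]; [rewrite mulr0 add0r | apply: homogeneous0].
Qed.

Lemma weightD c F G : weight c F -> weight c G -> weight c (F + G).
Proof.
move=> Fc Gc n k x grx; apply: subspaceD; first exact: grading_subspace.
  exact: Fc.
exact: Gc.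
Qed.

Lemma weightZ c a F : weight c F -> weight c (a *: F).
Proof.
move=> Fc n k x grx; apply: subspaceZ; first exact: grading_subspace.
exact: Fc.
Qed.

Lemma weightN c F : weight c F -> weight c (- F).
Proof. by rewrite -scaleN1r; apply: weightZ. Qed.

Lemma weightM c e F G : weight c F -> weight e G -> weight (c + e) (F * G).
Proof.
move=> Fc Ge n k x grx; rewrite scoef_mul endo_sum.
apply: subspace_sum => [|i]; first exact: grading_subspace.
have -> : k + (2 * n%:Z + (c + e)) =
    (k + (2 * (n - i)%N%:Z + e)) + (2 * (i : nat)%:Z + c).
  have -> : n%:Z = (n - i)%N%:Z + (i : nat)%:Z by rewrite -PoszD subnK // -ltnS.
  ring.
by apply: Fc; apply: Ge.
Qed.

Lemma weight1 : weight 0 1.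
Proof. by apply: weight_cseries => k x; rewrite addr0. Qed.

Lemma weightX F k : weight 0 F -> weight 0 (F ^+ k).
Proof.
move=> F0; elim: k => [|k IHk]; first exact: weight1.
by rewrite exprS -[0]addr0; apply: weightM.
Qed.

Lemma weight_exps F : weight 0 F -> weight 0 (exps F).
Proof.
move=> F0 n k x grx; rewrite /exps endo_sum.
apply: subspace_sum => [|i]; first exact: grading_subspace.
by apply: subspaceZ; [apply: grading_subspace | exact: (weightX i F0)].
Qed.

Lemma weight_drop_const F c : weight c F -> weight c (drop_const F).
Proof.
move=> Fc n; rewrite /drop_const.
by case: eqP => _; [apply: homogeneous0 | apply: Fc].
Qed.

End Weights.

Section Coefficients.
Variables (K : fieldType) (A : lmodType K).

Definition coefs (F : series A) : nat -> A -> A := fun n => F n.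

Lemma coefs_inj : injective coefs.
Proof.
move=> F G FG; apply: series_ext => n; apply: endo_ext => x.
by have := congr1 (fun f : nat -> A -> A => f n x) FG.
Qed.

Lemma coefs_mul F G : es_mul (coefs F) (coefs G) = coefs (F * G).
Proof.
apply/funext => n; apply/funext => x.
by rewrite /es_mul fct_sumE /coefs scoef_mul endo_sum.
Qed.

Lemma coefs_const (f : endo A) : es_const f = coefs (cseries f).
Proof. by apply/funext => n; rewrite /es_const /coefs /cseries; case: eqP. Qed.

Lemma coefs_pow F k : es_pow (coefs F) k = coefs (F ^+ k).
Proof.
elim: k => [|k IHk]; first exact: (coefs_const 1).
by rewrite exprS -coefs_mul -IHk.
Qed.

Lemma coefs_exp F : es_exp (coefs F) = coefs (exps F).
Proof.
apply/funext => n; apply/funext => x.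
rewrite /es_exp fct_sumE /coefs /exps endo_sum; apply: eq_bigr => k _.
by rewrite coefs_pow.
Qed.

Lemma coefs_opp F : - coefs F = coefs (- F).
Proof. by []. Qed.

Lemma graded_End_linear (gr : int -> set A) f :
  graded_End gr f -> f \in @is_linear K A.
Proof.
move=> [m [deg [g [_ ->]]]]; apply: rpred_sum => j _.
exact: linear_is_linear.
Qed.

Lemma homogeneous_graded_End (gr : int -> set A) n (f : endo A) :
  homogeneous gr gr n f -> graded_End gr f.
Proof.
move=> f_hom; exists 1%N, (fun=> n), (fun=> f); split=> //.
by rewrite big_ord1.
Qed.

End Coefficients.

Section Multicomplex.
Variables (K : fieldType) (A : lmodType K) (gr : int -> set A).
Hypothesis gradA : grading gr.
Variable Delta : nat -> {linear A -> A}.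
Hypothesis multiA : multicomplex gr Delta.

Definition total_differential : series A := fun n => endo_of (Delta n).
Definition perturbation : series A :=
  fun n => if n == 0%N then 0 else endo_of (Delta n).

Let D := total_differential.
Let delta := perturbation.
Let d : series A := cseries (endo_of (Delta 0)).

Lemma total_differentialE : D = d + delta.
Proof.
by apply: series_ext => -[|n]; rewrite scoef_add ?addr0 ?add0r.
Qed.

Lemma Delta0_square x : Delta 0 (Delta 0 x) = 0.
Proof. by have := multiA.2 0%N x; rewrite big_ord1. Qed.

Lemma cseries_d_square : d * d = 0.
Proof.
rewrite -cseriesM -cseries0; congr cseries.
by apply: endo_ext => x; apply: Delta0_square.
Qed.

Lemma total_differential_square : (d + delta) * (d + delta) = 0.
Proof.
rewrite -total_differentialE; apply: series_ext => n; apply: endo_ext => x.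
by rewrite scoef_mul endo_sum; exact: multiA.2.
Qed.

(** The compositions of n with k + 1 parts make up the coefficient of z^n of
    word k, and p, being linear, can be taken out of the sum. *)
Lemma degeneration_dataP (r : homotopy_retract gr (Delta 0)) :
  degeneration_data r <->
  forall n c, (1 <= n)%N ->
    hr_p r (\sum_(k < n) word (endo_of (hr_h r)) delta k n (hr_i r c)) = 0.
Proof.
have sumE n c : (1 <= n)%N ->
    \sum_(1 <= k < n.+1) \sum_(t : k.-tuple 'I_n.+1 |
        all (leq 1) (map val t) && (sumn (map val t) == n))
      hr_p r (zigzag Delta (hr_h r) (map val t) (hr_i r c)) =
    hr_p r (\sum_(k < n) word (endo_of (hr_h r)) delta k n (hr_i r c)).
  move=> n1; rewrite big_add1 /= big_mkord linear_sum; apply: eq_bigr => k _.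
  rewrite -linear_sum; congr (hr_p r _).
  apply: (zigzag_sum (endo_of (hr_h r)) (delta := delta) (f := Delta)) => //.
  by case.
by split=> degen n c n1; [rewrite -sumE // degen | rewrite sumE // degen].
Qed.

Section WithRetract.
Variable r : homotopy_retract gr (Delta 0).

Let h : series A := cseries (endo_of (hr_h r)).
Let pi : series A := cseries (endo_of (hr_i r \o hr_p r)).

Lemma retract_homotopyE : pi - 1 = d * h + h * d.
Proof.
rewrite -!cseriesM -cseriesD -cseries1 -cseriesN -cseriesD; congr cseries.
by apply: endo_ext => x; apply: (hr_homotopy r).
Qed.

Lemma d_pi : d * pi = 0.
Proof.
rewrite -cseriesM -cseries0; congr cseries; apply: endo_ext => x.
have [_ [iC _]] := hr_i_quasi r.
by rewrite endoM /= -iC linear0.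
Qed.

Lemma pi_d : pi * d = 0.
Proof.
rewrite -cseriesM -cseries0; congr cseries; apply: endo_ext => x.
have [_ pC] := hr_p_chain r.
by rewrite endoM /= pC linear0.
Qed.

Lemma perturbed_inclusion_exists :
  exists2 iota, iota = pi + h * delta * iota & weight gr 0 iota.
Proof.
have hd_weight : weight gr 0 (h * delta).
  rewrite -(subrr 1); apply: (weightM gradA).
    by apply: (weight_cseries gradA); apply: hr_h_degree.
  move=> [|n]; [exact: homogeneous0 | exact: multiA.1].
have [n F G FG|iota iotaE hom] := @contraction_fixpoint _ _
    (fun G => pi + h * delta * G).
  rewrite opprD addrACA subrr add0r -mulrBr -add1n; apply: vanishM => //.
  by apply: vanish1; rewrite scoef_mul0 mulr0.
exists iota => //.
apply: (hom (fun n f => homogeneous gr gr (2 * n%:Z + 0) f)) => [n|G Gw].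
  exact: homogeneous0.
apply: (weightD gradA); last by rewrite -[0]addr0; apply: (weightM gradA).
apply: (weight_cseries gradA) => k x grx.
rewrite -[0]addr0 addrA; have [i_hom _] := hr_i_quasi r.
by have [p_hom _] := hr_p_chain r; apply: i_hom; apply: p_hom.
Qed.

Lemma perturbed_inclusion_coef iota n x : iota = pi + h * delta * iota ->
  (delta * iota) n x =
  \sum_(k < n) word (endo_of (hr_h r)) delta k n (hr_i r (hr_p r x)).
Proof.
move=> iotaE; rewrite (zigzag_total_sum (erefl : delta 0%N = 0) n x iotaE) //.
by apply: eq_bigr => k _; rewrite scoef_mul_cst.
Qed.

Lemma degeneration_vanishing iota : iota = pi + h * delta * iota ->
  degeneration_data r -> pi * delta * iota = 0.
Proof.
move=> iotaE /degeneration_dataP degen; rewrite -mulrA.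
apply: series_ext => n; apply: endo_ext => x; rewrite scoef_cst_mul endoM /=.
case: n => [|n]; first by rewrite scoef_mul0 mul0r !linear0.
by rewrite (perturbed_inclusion_coef _ _ iotaE) degen // linear0.
Qed.

(** The equation p i = 1 allows to cancel i on the left and to replace i by
    (i p) i on the right. *)
Lemma vanishing_degeneration iota : iota = pi + h * delta * iota ->
  (forall c, hr_p r (hr_i r c) = c) ->
  pi * delta * iota = 0 -> degeneration_data r.
Proof.
move=> iotaE pK van; apply/degeneration_dataP => n c _.
have := congr1 (fun F : series A => hr_p r (F n (hr_i r c))) van.
rewrite -mulrA scoef_cst_mul endoM /= pK (perturbed_inclusion_coef _ _ iotaE).
by rewrite pK linear0.
Qed.

Lemma pi_idem : (forall c, hr_p r (hr_i r c) = c) -> pi * pi = pi.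
Proof.
move=> pK; rewrite -cseriesM; congr cseries; apply: endo_ext => x.
by rewrite endoM /= pK.
Qed.

End WithRetract.

Lemma strict_retract_exists :
  exists r : homotopy_retract gr (Delta 0), forall c, hr_p r (hr_i r c) = c.
Proof.
have d_hom : homogeneous gr gr (-1) (Delta 0) by exact: (multiA.1 0%N).
have [g g_hom gE] := homogeneous_generalized_inverse gradA d_hom.
exists (retract gradA Delta0_square gE d_hom g_hom) => c.
exact: (retract_pK Delta0_square gE c).
Qed.

Hypothesis charK0 : [pchar K] =i pred0.

Lemma conjugation_of_degeneration (r : homotopy_retract gr (Delta 0)) :
  degeneration_data r ->
  exists F : series A, [/\ weight gr 0 F, F 0%N = 0
    & exps F * d * exps (- F) = D].
Proof.
move=> degen; have [iota iotaE iota_weight] := perturbed_inclusion_exists r.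
set h := cseries (endo_of (hr_h r)); set pi := cseries _ in iotaE.
pose Phi := perturbation_iso d h delta iota.
have PhiE : D * Phi = Phi * d.
  rewrite total_differentialE.
  apply: (perturbation_iso_intertwines cseries_d_square (retract_homotopyE r)
    (d_pi r) (pi_d r) _ total_differential_square iotaE) => //.
  exact: degeneration_vanishing.
have Phi0 : Phi 0%N = 1.
  exact: (perturbation_iso_coef0 (retract_homotopyE r) _ iotaE).
have [F [F0 FPhi F_ind]] := log_exists Phi0.
have h_weight : weight gr 1 h.
  by apply: (weight_cseries gradA); apply: hr_h_degree.
have D_weight : weight gr (-1) D by exact: multiA.1.
have d_weight : weight gr (-1) d.
  by apply: (weight_cseries gradA); exact: (multiA.1 0%N).
have Phi_weight : weight gr 0 Phi.
  rewrite /Phi /perturbation_iso -total_differentialE.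
  apply: (weightD gradA); last first.
    by apply: (weightN gradA); rewrite -(subrr 1); apply: (weightM gradA).
  apply: (weightD gradA) => //.
  by apply: (weightN gradA); rewrite -(addNr 1); apply: (weightM gradA).
exists F; split=> //; last first.
  by rewrite FPhi -PhiE -FPhi -mulrA exps_mulN // mulr1.
apply: (F_ind (fun n f => homogeneous gr gr (2 * n%:Z + 0) f)) => [n|G Gw].
  exact: homogeneous0.
have drop_weight : weight gr 0 (drop_const G).
  by apply: (weight_drop_const gradA).
apply: (weightD gradA) => //; apply: (weightD gradA) => //.
by apply: (weightN gradA); apply: (weight_exps gradA).
Qed.

Lemma degeneration_of_conjugation (F : series A) : F 0%N = 0 ->
  exps F * d * exps (- F) = D ->
  exists r : homotopy_retract gr (Delta 0), degeneration_data r.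
Proof.
move=> F0 FD; have [r pK] := strict_retract_exists; exists r.
have [iota iotaE _] := perturbed_inclusion_exists r.
apply: (vanishing_degeneration iotaE pK).
set h := cseries (endo_of (hr_h r)); set pi := cseries _.
have [n G G' GG'|varpi varpiE _] := @contraction_fixpoint _ _
    (fun G => pi + G * (delta * h)).
  rewrite opprD addrACA subrr add0r -mulrBl -addn1; apply: vanishM => //.
  by apply: vanish1; rewrite scoef_mul0 mul0r.
apply: (degeneration_of_intertwiner cseries_d_square (retract_homotopyE r)
  (d_pi r) (pi_d r) _ total_differential_square iotaE (esym varpiE)
  (pi_idem pK) (exps_coef0 F)) => //.
by rewrite -total_differentialE -FD -mulrA exps_mulV // mulr1.
Qed.

End Multicomplex.

Theorem theorem2p1 (K : fieldType) (charK0 : [pchar K] =i pred0)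
    (A : lmodType K) (gr : int -> set A) (gradA : grading gr)
    (Delta : nat -> {linear A -> A}) (multiA : multicomplex gr Delta) :
  (exists r : homotopy_retract gr (Delta 0%N), degeneration_data r) <->
  (exists R : nat -> A -> A,
    [/\ forall n, graded_End gr (R n),
        R 0%N = 0
      & es_mul (es_mul (es_exp R) (es_const (Delta 0%N))) (es_exp (- R))
        = (fun n => Delta n : A -> A)]).
Proof.
have conjE (F : series A) :
    es_mul (es_mul (es_exp (coefs F)) (es_const (Delta 0%N)))
      (es_exp (- coefs F)) =
    coefs (exps F * cseries (endo_of (Delta 0%N)) * exps (- F)).
  rewrite coefs_opp !coefs_exp (coefs_const (endo_of (Delta 0%N))).
  by rewrite !coefs_mul.
split=> [[r degen]|[R [R_End R0]]].
  have [F [F_weight F0 FD]] :=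
    conjugation_of_degeneration gradA multiA charK0 degen.
  exists (coefs F); split=> [n||].
  - exact: homogeneous_graded_End (F_weight n).
  - by rewrite /coefs F0.
  - by rewrite conjE FD.
pose F : series A := fun n => Endo (graded_End_linear (R_End n)).
have -> : R = coefs F by [].
rewrite conjE => FD.
apply: (degeneration_of_conjugation gradA multiA charK0 (F := F)).
  by apply: endo_ext => x; rewrite /= R0.
by apply: coefs_inj; rewrite FD.
Qed.
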